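(* Let $\rho_1,\rho_2,r_1,r_2$ be real numbers such that $\rho_1+\rho_2-r_1-r_2\notin\{-1,-2,-3,\ldots\}$. For $0<q<1$ put $p=-q$, $$a=q^{2\rho_1+1/2},\quad b=-q^{-2r_2+1/2},\quad c=-q^{2\rho_2+1/2},\quad d=q^{-2r_1+1/2},$$ $$A_n=-\frac{(1+abp^n)(1-acp^n)(1-adp^n)(1-abcdp^{n-1})}{a(1-abcdp^{2n-1})(1-abcdp^{2n})},$$ $$C_n=\frac{a(1-p^n)(1-bcp^{n-1})(1-bdp^{n-1})(1+cdp^{n-1})}{(1-abcdp^{2n-2})(1-abcdp^{2n-1})},$$ with $C_0=0$, and let $\widehat{Q}_n(y)$ be the monic polynomials defined by $\widehat{Q}_{-1}=0$, $\widehat{Q}_0=1$ and $$y\,\widehat{Q}_n(y)=\widehat{Q}_{n+1}(y)+[a-a^{-1}-A_n-C_n]\widehat{Q}_n(y)+A_{n-1}C_n\widehat{Q}_{n-1}(y).$$ Then for every $n\geq0$ and every $x$, $$\lim_{q\to1^-}\frac{\widehat{Q}_n(q^x-q^{-x})}{(q-q^{-1})^n}=2^nB_n\left(\frac{x-1/2}{2}\right),$$ where $B_n$ are the Bannai--Ito polynomials with parameters $\rho_1,\rho_2,r_1,r_2$.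
   Context: The Bannai--Ito polynomials $B_n(x)$ are defined by $B_{-1}(x)=0$, $B_0(x)=1$ and $$xB_n(x)=B_{n+1}(x)+(\rho_1-\mathsf{A}_n-\mathsf{C}_n)B_n(x)+\mathsf{A}_{n-1}\mathsf{C}_nB_{n-1}(x),$$ where, with $\kappa=\rho_1+\rho_2-r_1-r_2+\tfrac12$, $$\mathsf{A}_n=\frac{(n+2\rho_1-2r_1+1)(n+2\rho_1-2r_2+1)}{4(n+\kappa+1/2)}\ (n\text{ even}),\qquad \mathsf{A}_n=\frac{(n+2\kappa)(n+2\rho_1+2\rho_2+1)}{4(n+\kappa+1/2)}\ (n\text{ odd}),$$ $$\mathsf{C}_n=-\frac{n(n-2r_1-2r_2)}{4(n+\kappa-1/2)}\ (n\text{ even}),\qquad \mathsf{C}_n=-\frac{(n+2\rho_2-2r_1)(n+2\rho_2-2r_2)}{4(n+\kappa-1/2)}\ (n\text{ odd}),$$ with $\mathsf{C}_0=0$. The polynomials $\widehat{Q}_n$ are the monic versions (in the variable $y=z-z^{-1}$) of the polynomials $Q_n$ defined by $Q_{-1}=0$, $Q_0=1$, $(z-z^{-1})Q_n=A_nQ_{n+1}+[a-a^{-1}-A_n-C_n]Q_n+C_nQ_{n-1}$. *)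

(* Defs.v *)
From HB Require Import structures.
From mathcomp Require Export all_boot all_order all_algebra.
From mathcomp Require Export all_classical all_reals all_analysis.
From mathcomp Require Export complex.

Set Implicit Arguments.
Unset Strict Implicit.
Unset Printing Implicit Defensive.

Export Order.TTheory GRing.Theory Num.Theory.
Export numFieldNormedType.Exports.

Local Open Scope ring_scope.
Local Open Scope complex_scope.

(* The monic polynomials with P_(-1) = 0, P_0 = 1 and
   X * P_n = P_(n+1) + beta_n * P_n + gamma_n * P_(n-1); the value gamma_0 is
   never used. See [three_term_rec]. *)
Fixpoint three_term (R : comNzRingType) (beta gamma : nat -> R) (n : nat)
    : {poly R} :=
  match n with
  | 0%N => 1
  | n1.+1 =>
    let Pprev := if n1 is n2.+1 then three_term beta gamma n2 else 0 in
    'X * three_term beta gamma n1 - beta n1 *: three_term beta gamma n1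
      - gamma n1 *: Pprev
  end.

Lemma three_term_rec (R : comNzRingType) (beta gamma : nat -> R) (n : nat) :
  'X * three_term beta gamma n =
    three_term beta gamma n.+1 + beta n *: three_term beta gamma n
      + gamma n *: (if n is n1.+1 then three_term beta gamma n1 else 0).
Proof. by rewrite [RHS]addrAC; case: n => [|n]; rewrite [RHS]/= !subrK. Qed.

Definition BI_kappa (R : realType) (rho1 rho2 r1 r2 : R) : R :=
  rho1 + rho2 - r1 - r2 + 1 / 2.

Definition BI_A (R : realType) (rho1 rho2 r1 r2 : R) (n : nat) : R :=
  let kappa := BI_kappa rho1 rho2 r1 r2 in
  if odd n then
    (n%:R + 2 * kappa) * (n%:R + 2 * rho1 + 2 * rho2 + 1)
      / (4 * (n%:R + kappa + 1 / 2))
  else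
    (n%:R + 2 * rho1 - 2 * r1 + 1) * (n%:R + 2 * rho1 - 2 * r2 + 1)
      / (4 * (n%:R + kappa + 1 / 2)).

Definition BI_C (R : realType) (rho1 rho2 r1 r2 : R) (n : nat) : R :=
  let kappa := BI_kappa rho1 rho2 r1 r2 in
  if n == 0%N then 0
  else if odd n then
    - ((n%:R + 2 * rho2 - 2 * r1) * (n%:R + 2 * rho2 - 2 * r2)
        / (4 * (n%:R + kappa - 1 / 2)))
  else
    - (n%:R * (n%:R - 2 * r1 - 2 * r2) / (4 * (n%:R + kappa - 1 / 2))).

Definition BannaiIto (R : realType) (rho1 rho2 r1 r2 : R) : nat -> {poly R} :=
  let A := BI_A rho1 rho2 r1 r2 in
  let C := BI_C rho1 rho2 r1 r2 in
  three_term (fun n => rho1 - A n - C n) (fun n => A n.-1 * C n).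

(* The exponents n - 1, 2n - 1, 2n - 2 are integers: n - 1 = -1 occurs in A_0. *)
Definition Qhat_A (R : realType) (p a b c d : R) (n : nat) : R :=
  - ((1 + a * b * p ^+ n) * (1 - a * c * p ^+ n) * (1 - a * d * p ^+ n)
       * (1 - a * b * c * d * p ^ (n%:Z - 1))
     / (a * (1 - a * b * c * d * p ^ (2 * n%:Z - 1))
          * (1 - a * b * c * d * p ^+ (2 * n)))).

Definition Qhat_C (R : realType) (p a b c d : R) (n : nat) : R :=
  if n == 0%N then 0
  else
    a * (1 - p ^+ n) * (1 - b * c * p ^ (n%:Z - 1))
      * (1 - b * d * p ^ (n%:Z - 1)) * (1 + c * d * p ^ (n%:Z - 1))
    / ((1 - a * b * c * d * p ^ (2 * n%:Z - 2))
         * (1 - a * b * c * d * p ^ (2 * n%:Z - 1))).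

Definition Qhat (R : realType) (p a b c d : R) : nat -> {poly R} :=
  let A := Qhat_A p a b c d in
  let C := Qhat_C p a b c d in
  three_term (fun n => a - a^-1 - A n - C n) (fun n => A n.-1 * C n).

(* The complex exponential, exp (u + i v) = exp u * (cos v + i sin v). *)
Definition cexp (R : realType) (z : R[i]) : R[i] :=
  (expR (complex.Re z))%:C * (cos (complex.Im z) +i* sin (complex.Im z)).

(* The power q^x of a positive real q with complex exponent x. *)
Definition cpow (R : realType) (q : R) (x : R[i]) : R[i] :=
  cexp (x * (ln q)%:C).

(* Evaluation at a complex point of a polynomial with real coefficients. *)
Definition ceval (R : realType) (P : {poly R}) (z : R[i]) : R[i] :=
  (map_poly (real_complex R) P).[z].

(* Main.v *)
Require Import Defs.
From mathcomp Require Import ring lra.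

Set Implicit Arguments.
Unset Strict Implicit.
Unset Printing Implicit Defensive.

(** Both families obey three-term recurrences, so it suffices to compare
    recurrence data. With u = q - q^-1, dividing the n-th polynomial by u^n
    divides the coefficients beta_n, gamma_n and the point by u, u^2 and u. The
    point tends to x, and A_n / u, C_n / u tend to twice the Bannai-Ito A_n, C_n,
    as each factor 1 - q^r is asymptotic to - r / 2 * u. The limit recurrence is
    the Bannai-Ito one after the substitution x -> (x - 1/2) / 2. *)

Local Open Scope classical_set_scope.
Local Open Scope ring_scope.
Local Open Scope complex_scope.

(** * Three-term recurrences: evaluation, affine substitution, limits *)

Lemma ceval_three_termS (R : realType) (beta gamma : nat -> R) n (z : R[i]) :
  ceval (three_term beta gamma n.+1) z =
    (z - (beta n)%:C) * ceval (three_term beta gamma n) z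
    - (gamma n)%:C *
        (if n is n1.+1 then ceval (three_term beta gamma n1) z else 0).
Proof.
have E : three_term beta gamma n.+1 =
    'X * three_term beta gamma n - (beta n)%:P * three_term beta gamma n
    - (gamma n)%:P * (if n is n1.+1 then three_term beta gamma n1 else 0).
  by rewrite !mul_polyC.
rewrite /ceval E !rmorphB !rmorphM /= map_polyX !map_polyC !hornerE mulrBl.
by case: n {E} => [|n] //; rewrite rmorph0 horner0.
Qed.

(** By induction: replacing the variable by [(x - t) / s] and multiplying by [s ^+ n] restores the
    recurrence, with [beta] rescaled and shifted and [gamma] picking up one [s] for each of the two
    degrees it bridges. *)
Lemma ceval_three_term_affine (R : realType) (beta gamma : nat -> R) (s t : R)
    (n : nat) (x : R[i]) : s != 0 ->
  ceval (three_term (fun k => s * beta k + t) (fun k => s ^+ 2 * gamma k) n) x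
  = (s ^+ n)%:C * ceval (three_term beta gamma n) ((x - t%:C) / s%:C).
Proof.
move=> s0; have sC0 : s%:C != 0 :> R[i] by rewrite fmorph_eq0.
have base : forall b g : nat -> R, forall z, ceval (three_term b g 0) z = 1.
  by move=> b g z; rewrite /ceval /= rmorph1 hornerE.
elim/ltn_ind: n => -[|n] IH; first by rewrite !base expr0 mulr1.
rewrite !ceval_three_termS IH//.
case: n IH => [|n] IH; last rewrite IH//; rewrite ?exprS ?rmorphM ?rmorphD /=.
  by rewrite expr0 rmorph1 rmorphM /=; field.
by rewrite ?expr0 ?rmorph1 ?rmorphM /=; field.
Qed.

Lemma cvg_real_complex (R : realType) (T : Type) (F : set_system T)
    {FF : Filter F} (f : T -> R) (l : R) :
  f @ F --> l -> ((f t)%:C : R[i]^o) @[t --> F] --> (l%:C : R[i]^o).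
Proof.
move=> /cvgrPdist_lt fl; apply/cvgrPdist_lt => -[e e'].
(* A positive element of [R[i]] is real, so the radius is a positive real number. *)
rewrite ltcE /= => /andP[/eqP-> e0]; near=> t.
rewrite -rmorphB normc_def /= expr0n addr0 sqrtr_sqr ltcR.
by near: t; exact: fl.
Unshelve. all: by end_near.
Qed.

Lemma cvgBM (K : numFieldType) (T : Type) (F : set_system T) {FF : Filter F}
    (f g h k : T -> K^o) (a b c d : K^o) :
  f @ F --> a -> g @ F --> b -> h @ F --> c -> k @ F --> d ->
  (f t * g t - h t * k t : K^o) @[t --> F] --> (a * b - c * d : K^o).
Proof. by move=> fa gb hc kd; apply: cvgB; exact: cvgM. Qed.

(** Strong induction: the recurrence for the next polynomial, divided by the next power of [u],
    expresses the quotient through [z / u], [beta / u], [gamma / u ^+ 2] and the two previous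
    quotients, all with known limits. This identity holds only where [u] is nonzero, hence near
    [F]. *)
Lemma cvg_three_term (R : realType) (T : Type) (F : set_system T)
    {FF : Filter F} (beta gamma : T -> nat -> R) (z : T -> R[i]) (u : T -> R)
    (beta0 gamma0 : nat -> R) (z0 : R[i]) (n : nat) :
  (\forall t \near F, u t != 0) ->
  (forall k, beta t k / u t @[t --> F] --> beta0 k) ->
  (forall k, gamma t k / u t ^+ 2 @[t --> F] --> gamma0 k) ->
  (z t / (u t)%:C : R[i]^o) @[t --> F] --> (z0 : R[i]^o) ->
  (ceval (three_term (beta t) (gamma t) n) (z t) / (u t ^+ n)%:C : R[i]^o)
    @[t --> F] --> (ceval (three_term beta0 gamma0 n) z0 : R[i]^o).
Proof.
move=> u0 hb hg hz.
have base : forall b g : nat -> R, forall z, ceval (three_term b g 0) z = 1.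
  by move=> b g w; rewrite /ceval /= rmorph1 hornerE.
elim/ltn_ind: n => -[|n] IH.
  rewrite base; apply: cvg_near_cst; apply: nearW => t.
  by rewrite base expr0 rmorph1 divr1.
rewrite ceval_three_termS.
pose proof (cvg_real_complex (hb n)) as hB.
pose proof (cvg_real_complex (hg n)) as hG.
have key : ((z t / (u t)%:C - (beta t n / u t)%:C) *
   (ceval (three_term (beta t) (gamma t) n) (z t) / (u t ^+ n)%:C)
   - (gamma t n / u t ^+ 2)%:C *
     (if n is m.+1 then
        ceval (three_term (beta t) (gamma t) m) (z t) / (u t ^+ m)%:C else 0)
     : R[i]^o) @[t --> F] -->
   ((z0 - (beta0 n)%:C) * ceval (three_term beta0 gamma0 n) z0 -
    (gamma0 n)%:C * (if n is m.+1 then ceval (three_term beta0 gamma0 m) z0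
                     else 0) : R[i]^o).
  pose proof (cvgB hz hB) as t1.
  have t2 := (IH n (leqnn _)).
  have t3 : ((if n is m.+1 then
        ceval (three_term (beta t) (gamma t) m) (z t) / (u t ^+ m)%:C else 0)
     : R[i]^o) @[t --> F] --> ((if n is m.+1 then
        ceval (three_term beta0 gamma0 m) z0 else 0) : R[i]^o).
    by case: n {hB hG t1 t2} IH => [|m] IH; [exact: cvg_cst | exact: IH].
  by pose proof (cvgBM t1 t2 hG t3) as t4; exact: t4.
apply: cvg_trans key; apply: near_eq_cvg.
near=> t.
have uC0 : (u t)%:C != 0 :> R[i] by rewrite fmorph_eq0; near: t.
rewrite /= ceval_three_termS; case: n {IH hB hG} => [|m].
  by rewrite !mulr0 !subr0 rmorphM fmorphV expr0 expr1 rmorph1 /=; field.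
rewrite !exprS !rmorphM /= !fmorphV !rmorphM /= !rmorphXn /=.
by field; rewrite expf_neq0.
Unshelve. all: by end_near.
Qed.

(** * First-order asymptotics of real and complex powers as q tends to 1 *)

(** Since [f 1 = 0], [f q / (q - 1)] is a difference quotient at 1, and
    [(q - 1) / (q - q^-1) = q / (q + 1)] tends to 1/2. *)
Lemma cvg_div_subV (R : realType) (f : R -> R) (l : R) :
  is_derive (1 : R) 1 f l -> f 1 = 0 ->
  f q / (q - q^-1) @[q --> (1 : R)^'-] --> l / 2.
Proof.
move=> [df fl] f1.
have dq : f q / (q - 1) @[q --> (1 : R)^'-] --> l.
  (* The derivative is a limit in the increment over a punctured neighbourhood of 0; the increment
     here is [q - 1]. *)
  have sh : (q - 1) @[q --> (1 : R)^'-] --> (0 : R)^'.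
    move=> A [e /= e0 hA]; exists e => // q /= qe q1.
    apply: hA => /=; last by rewrite subr_eq0 lt_eqF.
    by rewrite sub0r opprB.
  have := cvg_comp _ _ sh df; rewrite -fl.
  apply: cvg_trans; apply: near_eq_cvg; near=> q => /=.
  by rewrite f1 subr0 mulrC /GRing.scale /= mulr1 subrK.
have dr : q / (q + 1) @[q --> (1 : R)^'-] --> (1 / (1 + 1) : R).
  have id1 : q @[q --> (1 : R)^'-] --> (1 : R) by apply: cvg_at_left_filter.
  apply: cvgM => //; apply: cvgV; first by apply: lt0r_neq0; lra.
  by apply: cvgD => //; exact: cvg_cst.
have -> : l / 2 = l * (1 / (1 + 1)) by field.
apply: cvg_trans (cvgM dq dr); apply: near_eq_cvg; near=> q => /=.
have q0 : 0 < q by near: q; exact: nbhs_left_gt.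
have q1 : q < 1 by near: q; exact: nbhs_left_lt.
by field; rewrite /=; do ?[apply/andP; split]; apply/eqP; nra.
Unshelve. all: by end_near.
Qed.

Lemma is_derive_powR1 (R : realType) (r : R) :
  is_derive (1 : R) 1 (fun q => q `^ r) r.
Proof.
apply: is_derive_eq; first exact: is_derive1_powR.
by rewrite powR1 mulr1.
Qed.

Lemma cvg_powR1 (R : realType) (r : R) :
  q `^ r @[q --> (1 : R)^'-] --> (1 : R).
Proof.
have [d _] := is_derive_powR1 r.
have /derivable1_diffP/differentiable_continuous := d.
by move=> /cvg_at_left_filter; rewrite powR1.
Qed.

Lemma cvg_subr_powR (R : realType) (r : R) :
  (1 - q `^ r) / (q - q^-1) @[q --> (1 : R)^'-] --> - r / 2.
Proof.
apply: cvg_div_subV; last by rewrite powR1 subrr.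
have := is_derive_powR1 r => ?.
by apply: is_derive_eq; ring.
Qed.

(** For x = u + iv the numerator is [f q + 'i * g q] with f = 2 sinh(u ln q) cos(v ln q) and g = 2
    cosh(u ln q) sin(v ln q). Both vanish at 1, with derivatives 2u and 2v there. *)
Lemma cvg_cpow_subr (R : realType) (x : R[i]) :
  ((cpow q x - cpow q (- x)) / (q - q^-1)%:C : R[i]^o) @[q --> (1 : R)^'-]
    --> (x : R[i]^o).
Proof.
case: x => u v.
pose f q := (expR (u * ln q) - expR (- (u * ln q))) * cos (v * ln q).
pose g q := (expR (u * ln q) + expR (- (u * ln q))) * sin (v * ln q).
have dln : is_derive (1 : R) 1 (@ln R) 1.
  by apply: is_derive_eq; first exact: is_derive1_ln; rewrite invr1.
have hf : f q / (q - q^-1) @[q --> (1 : R)^'-] --> u.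
  have -> : u = (2 * u) / 2 by field.
  apply: cvg_div_subV; last by rewrite /f ln1 mulr0 oppr0 subrr mul0r.
  apply: is_derive_eq.
  rewrite ln1 !mulr0 oppr0 expR0 cos0 sin0 /GRing.scale /=; ring.
have hg : g q / (q - q^-1) @[q --> (1 : R)^'-] --> v.
  have -> : v = (2 * v) / 2 by field.
  apply: cvg_div_subV; last by rewrite /g ln1 !mulr0 sin0 mulr0.
  apply: is_derive_eq.
  rewrite ln1 !mulr0 oppr0 expR0 cos0 sin0 /GRing.scale /=; ring.
pose proof (cvg_real_complex hf) as hfC.
pose proof (cvg_real_complex hg) as hgC.
have ci : (('i : R[i]) : R[i]^o) @[q --> (1 : R)^'-] --> ('i : R[i]^o).
  exact: cvg_cst.
have E : u%:C + 'i * v%:C = u +i* v.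
  by apply/eqP; rewrite eq_complex /=; apply/andP; split; apply/eqP; ring.
pose proof (cvgD hfC (cvgM ci hgC)) as key.
rewrite E in key.
apply: cvg_trans key; apply: near_eq_cvg; apply: nearW => q.
rewrite /cpow /cexp /= -fmorphV /= !mulr0 !subr0 !mulNr !add0r cosN sinN.
apply/eqP; rewrite eq_complex /f /g /=.
by apply/andP; split; apply/eqP; ring.
Qed.

(** * The coefficients of [Qhat] as ratios of factors 1 - q^r and 1 + q^r *)

(* For p = - q the sign (-1)^n decides which factors of A_n and C_n vanish as
   q tends to 1 and which tend to 2. *)
Lemma Qhat_AE (R : realType) (rho1 rho2 r1 r2 q : R) (n : nat) : 0 < q ->
  let s : R := (-1) ^+ n in
  Qhat_A (- q) (q `^ (2 * rho1 + 1 / 2)) (- q `^ (- 2 * r2 + 1 / 2))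
    (- q `^ (2 * rho2 + 1 / 2)) (q `^ (- 2 * r1 + 1 / 2)) n =
  - ((1 - s * q `^ (n%:R + 2 * rho1 - 2 * r2 + 1))
     * (1 + s * q `^ (n%:R + 2 * rho1 + 2 * rho2 + 1))
     * (1 - s * q `^ (n%:R + 2 * rho1 - 2 * r1 + 1))
     * (1 + s * q `^ (n%:R + 2 * BI_kappa rho1 rho2 r1 r2))
     / (q `^ (2 * rho1 + 1 / 2)
        * (1 + q `^ (2 * n%:R + 2 * BI_kappa rho1 rho2 r1 r2))
        * (1 - q `^ (2 * n%:R + 2 * BI_kappa rho1 rho2 r1 r2 + 1)))).
Proof.
move=> q0 s; have q0' : q != 0 by rewrite gt_eqF.
have pD x y : q `^ (x + y) = q `^ x * q `^ y.
  by rewrite powRD// q0' implybT.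
rewrite /Qhat_A /BI_kappa.
have e1 : (- q) ^ (n%:Z - 1) = - s * q `^ (n%:R - 1).
  rewrite expfzDr ?oppr_eq0// pD powRN powRr1 ?ltW// powR_mulrn ?ltW//.
  rewrite -exprnP exprNn -/s exprN1 invrN; ring.
(* The exponents 2n - 1 and 2n have fixed parity, so the denominator is free of [s]. *)
have e2 : (- q) ^ (2 * n%:Z - 1) = - q `^ (2 * n%:R - 1).
  rewrite expfzDr ?oppr_eq0// pD powRN powRr1 ?ltW// -natrM powR_mulrn ?ltW//.
  rewrite -PoszM -exprnP [(- q) ^+ _]exprM sqrrN -exprM.
  rewrite exprN1 invrN; ring.
have e3 : (- q) ^+ (2 * n) = q `^ (2 * n%:R).
  by rewrite -natrM powR_mulrn ?ltW// [(- q) ^+ _]exprM sqrrN -exprM.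
have e4 : (- q) ^+ n = s * q `^ n%:R by rewrite powR_mulrn ?ltW// exprNn.
have f1 : q `^ (n%:R + 2 * rho1 - 2 * r2 + 1) =
    q `^ n%:R * q `^ (2 * rho1 + 1 / 2) * q `^ (- 2 * r2 + 1 / 2).
  by rewrite -!pD; congr (_ `^ _); field.
have f2 : q `^ (n%:R + 2 * rho1 + 2 * rho2 + 1) =
    q `^ n%:R * q `^ (2 * rho1 + 1 / 2) * q `^ (2 * rho2 + 1 / 2).
  by rewrite -!pD; congr (_ `^ _); field.
have f3 : q `^ (n%:R + 2 * rho1 - 2 * r1 + 1) =
    q `^ n%:R * q `^ (2 * rho1 + 1 / 2) * q `^ (- 2 * r1 + 1 / 2).
  by rewrite -!pD; congr (_ `^ _); field.
(* [Q] is the product abcd, where the signs of b and c cancel; it equals q^(2 kappa + 1). *)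
pose Q := q `^ (2 * rho1 + 1 / 2) * q `^ (- 2 * r2 + 1 / 2)
  * q `^ (2 * rho2 + 1 / 2) * q `^ (- 2 * r1 + 1 / 2).
have f4 : q `^ (n%:R + 2 * BI_kappa rho1 rho2 r1 r2) = Q * q `^ (n%:R - 1).
  by rewrite /Q /BI_kappa -!pD; congr (_ `^ _); field.
have f5 : q `^ (2 * n%:R + 2 * BI_kappa rho1 rho2 r1 r2) =
    Q * q `^ (2 * n%:R - 1).
  by rewrite /Q /BI_kappa -!pD; congr (_ `^ _); field.
have f6 : q `^ (2 * n%:R + 2 * BI_kappa rho1 rho2 r1 r2 + 1) =
    Q * q `^ (2 * n%:R).
  by rewrite /Q /BI_kappa -!pD; congr (_ `^ _); field.
rewrite f1 f2 f3 f4 f5 f6 e1 e2 e3 e4 /Q.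
by congr (- (_ / _)); ring.
Qed.

(** The common shape of A_n and C_n in either parity: two vanishing factors above, one below, so the
    ratio is of first order in [q - q^-1]. The remaining factor [h] will be -1/a for A_n and a for
    C_n. *)
Lemma cvg_ratio_subr_powR (R : realType) (h : R -> R)
    (h0 al be ga al' be' ga' : R) : ga != 0 ->
  h q @[q --> (1 : R)^'-] --> h0 ->
  (1 - q `^ al) * (1 - q `^ be) * (1 + q `^ al') * (1 + q `^ be') * h q
    / ((1 - q `^ ga) * (1 + q `^ ga')) / (q - q^-1) @[q --> (1 : R)^'-]
  --> - (h0 * al * be / ga).
Proof.
move=> ga0 hh.
have cG r : (1 + q `^ r) @[q --> (1 : R)^'-] --> (2 : R).
  by apply: cvgD; [exact: cvg_cst | exact: cvg_powR1].
have cE := @cvg_subr_powR R.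
have ga2 : - ga / 2 != 0 by rewrite mulf_neq0 ?oppr_eq0// invr_neq0.
have two0 : 2 != 0 :> R by rewrite pnatr_eq0.
pose proof (cvgM (cvgM (cvgM (cvgM (cvgM (cE al) (cE be)) (cG al')) (cG be'))
  hh) (cvgM (cvgV ga2 (cE ga)) (cvgV two0 (cG ga')))) as key.
have -> : - (h0 * al * be / ga) =
  - al / 2 * (- be / 2) * 2 * 2 * h0 * ((- ga / 2)^-1 * 2^-1) by field.
apply: cvg_trans key; apply: near_eq_cvg; near=> q => /=.
have q0 : 0 < q by near: q; exact: nbhs_left_gt.
have q1 : q < 1 by near: q; exact: nbhs_left_lt.
have u0 : q - q^-1 != 0.
  by rewrite subr_eq0 lt_eqF// (lt_trans q1)// invf_gt1.
rewrite /GRing.mul_fun /= ?invf_div invfM.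
(* With the inverses abstracted, [w != 0] is the only side condition left to [field]. *)
move: (q - q^-1) u0 (1 - q `^ ga)^-1 (1 + q `^ ga')^-1 => w w0 x y.
by field.
Unshelve. all: by end_near.
Qed.


(** Here p^(n-1) contributes the sign [- s], combined with the negative b and c. As q tends to 1,
    even n makes the factors with [1 - s] vanish, odd n those with [1 + s]. *)
Lemma Qhat_CE (R : realType) (rho1 rho2 r1 r2 q : R) (n : nat) :
  0 < q -> (0 < n)%N ->
  let s : R := (-1) ^+ n in
  Qhat_C (- q) (q `^ (2 * rho1 + 1 / 2)) (- q `^ (- 2 * r2 + 1 / 2))
    (- q `^ (2 * rho2 + 1 / 2)) (q `^ (- 2 * r1 + 1 / 2)) n =
  q `^ (2 * rho1 + 1 / 2) * (1 - s * q `^ n%:R)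
    * (1 + s * q `^ (n%:R + 2 * rho2 - 2 * r2))
    * (1 - s * q `^ (n%:R - 2 * r1 - 2 * r2))
    * (1 + s * q `^ (n%:R + 2 * rho2 - 2 * r1))
    / ((1 - q `^ (2 * n%:R + 2 * BI_kappa rho1 rho2 r1 r2 - 1))
       * (1 + q `^ (2 * n%:R + 2 * BI_kappa rho1 rho2 r1 r2))).
Proof.
move=> q0 n0 s; have q0' : q != 0 by rewrite gt_eqF.
have pD x y : q `^ (x + y) = q `^ x * q `^ y.
  by rewrite powRD// q0' implybT.
rewrite /Qhat_C eqn0Ngt n0 /=.
have e1 : (- q) ^ (n%:Z - 1) = - s * q `^ (n%:R - 1).
  rewrite expfzDr ?oppr_eq0// pD powRN powRr1 ?ltW// powR_mulrn ?ltW//.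
  rewrite -exprnP exprNn -/s exprN1 invrN; ring.
have e2 : (- q) ^ (2 * n%:Z - 1) = - q `^ (2 * n%:R - 1).
  rewrite expfzDr ?oppr_eq0// pD powRN powRr1 ?ltW// -natrM powR_mulrn ?ltW//.
  rewrite -PoszM -exprnP [(- q) ^+ _]exprM sqrrN -exprM.
  rewrite exprN1 invrN; ring.
have e3 : (- q) ^ (2 * n%:Z - 2) = q `^ (2 * n%:R - 2).
  rewrite expfzDr ?oppr_eq0// pD -natrM powR_mulrn ?ltW// powR_invn ?ltW//.
  rewrite -PoszM -exprnP [(- q) ^+ _]exprM sqrrN -exprM.
  by rewrite -exprnN sqrrN.
have e4 : (- q) ^+ n = s * q `^ n%:R by rewrite powR_mulrn ?ltW// exprNn.
have f1 : q `^ (n%:R + 2 * rho2 - 2 * r2) =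
    q `^ (n%:R - 1) * q `^ (2 * rho2 + 1 / 2) * q `^ (- 2 * r2 + 1 / 2).
  by rewrite -!pD; congr (_ `^ _); field.
have f2 : q `^ (n%:R - 2 * r1 - 2 * r2) =
    q `^ (n%:R - 1) * q `^ (- 2 * r1 + 1 / 2) * q `^ (- 2 * r2 + 1 / 2).
  by rewrite -!pD; congr (_ `^ _); field.
have f3 : q `^ (n%:R + 2 * rho2 - 2 * r1) =
    q `^ (n%:R - 1) * q `^ (2 * rho2 + 1 / 2) * q `^ (- 2 * r1 + 1 / 2).
  by rewrite -!pD; congr (_ `^ _); field.
pose Q := q `^ (2 * rho1 + 1 / 2) * q `^ (- 2 * r2 + 1 / 2)
  * q `^ (2 * rho2 + 1 / 2) * q `^ (- 2 * r1 + 1 / 2).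
have f5 : q `^ (2 * n%:R + 2 * BI_kappa rho1 rho2 r1 r2) =
    Q * q `^ (2 * n%:R - 1).
  by rewrite /Q /BI_kappa -!pD; congr (_ `^ _); field.
have f6 : q `^ (2 * n%:R + 2 * BI_kappa rho1 rho2 r1 r2 - 1) =
    Q * q `^ (2 * n%:R - 2).
  by rewrite /Q /BI_kappa -!pD; congr (_ `^ _); field.
rewrite f1 f2 f3 f5 f6 e1 e2 e3 e4 /Q.
by congr (_ / _); ring.
Qed.

(** * Limits of the rescaled recurrence coefficients *)

(** The vanishing denominator factor has exponent 2n + 2 kappa + 1 = 2 (n + 1 + rho1 + rho2 - r1 -
    r2), which the hypothesis keeps nonzero. It is half of the Bannai-Ito denominator 4 (n + kappa +
    1/2), whence the factor 2. *)
Lemma cvg_Qhat_A (R : realType) (rho1 rho2 r1 r2 : R) (n : nat) :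
  rho1 + rho2 - r1 - r2 <> - n.+1%:R ->
  Qhat_A (- q) (q `^ (2 * rho1 + 1 / 2)) (- q `^ (- 2 * r2 + 1 / 2))
    (- q `^ (2 * rho2 + 1 / 2)) (q `^ (- 2 * r1 + 1 / 2)) n / (q - q^-1)
    @[q --> (1 : R)^'-] --> 2 * BI_A rho1 rho2 r1 r2 n.
Proof.
move=> hr.
have ga0 : 2 * n%:R + 2 * BI_kappa rho1 rho2 r1 r2 + 1 != 0.
  apply/eqP => E; apply: hr; move: E; rewrite /BI_kappa -[n.+1]addn1 natrD; lra.
have hh : - (q `^ (2 * rho1 + 1 / 2))^-1 @[q --> (1 : R)^'-] --> (-1 : R).
  pose proof (cvgN (cvgV (oner_neq0 R) (cvg_powR1 (2 * rho1 + 1 / 2)))) as hN.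
  by rewrite invr1 in hN.
rewrite /BI_A; case: ifP => on.
(* For odd n the factors with [1 + s] vanish in the limit; their exponents are the numerator factors
   of the odd [BI_A]. The even case exchanges the roles. *)
- pose proof (@cvg_ratio_subr_powR R _ _
    (n%:R + 2 * BI_kappa rho1 rho2 r1 r2)
    (n%:R + 2 * rho1 + 2 * rho2 + 1) _ (n%:R + 2 * rho1 - 2 * r2 + 1)
    (n%:R + 2 * rho1 - 2 * r1 + 1)
    (2 * n%:R + 2 * BI_kappa rho1 rho2 r1 r2) ga0 hh) as key.
  set l := (X in _ --> X) in key; set l' := (X in _ --> X).
  have <- : l = l'.
    by rewrite /l /l'; field; apply: contra_neq ga0 => E; lra.
  apply: cvg_trans key; apply: near_eq_cvg; near=> q => /=.
  have q0 : 0 < q by near: q; exact: nbhs_left_gt.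
  rewrite Qhat_AE// -signr_odd on expr1 !mulN1r !opprK !invfM; ring.
- pose proof (@cvg_ratio_subr_powR R _ _
    (n%:R + 2 * rho1 - 2 * r1 + 1) (n%:R + 2 * rho1 - 2 * r2 + 1) _
    (n%:R + 2 * rho1 + 2 * rho2 + 1)
    (n%:R + 2 * BI_kappa rho1 rho2 r1 r2)
    (2 * n%:R + 2 * BI_kappa rho1 rho2 r1 r2) ga0 hh) as key.
  set l := (X in _ --> X) in key; set l' := (X in _ --> X).
  have <- : l = l'.
    by rewrite /l /l'; field; apply: contra_neq ga0 => E; lra.
  apply: cvg_trans key; apply: near_eq_cvg; near=> q => /=.
  have q0 : 0 < q by near: q; exact: nbhs_left_gt.
  rewrite Qhat_AE// -signr_odd on expr0 !mul1r !invfM; ring.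
Unshelve. all: by end_near.
Qed.

(** The critical exponent is now 2n + 2 kappa - 1 = 2 (n + rho1 + rho2 - r1 - r2), so the excluded
    value shifts by one. As a tends to 1, the minus sign of [BI_C] is the one from
    [cvg_ratio_subr_powR]. *)
Lemma cvg_Qhat_C (R : realType) (rho1 rho2 r1 r2 : R) (n : nat) :
  (0 < n)%N -> rho1 + rho2 - r1 - r2 <> - n%:R ->
  Qhat_C (- q) (q `^ (2 * rho1 + 1 / 2)) (- q `^ (- 2 * r2 + 1 / 2))
    (- q `^ (2 * rho2 + 1 / 2)) (q `^ (- 2 * r1 + 1 / 2)) n / (q - q^-1)
    @[q --> (1 : R)^'-] --> 2 * BI_C rho1 rho2 r1 r2 n.
Proof.
move=> n0 hr.
have ga0 : 2 * n%:R + 2 * BI_kappa rho1 rho2 r1 r2 - 1 != 0.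
  apply/eqP => E; apply: hr; move: E; rewrite /BI_kappa; lra.
have hh := cvg_powR1 (2 * rho1 + 1 / 2).
rewrite /BI_C eqn0Ngt n0 /=; case: ifP => on.
- pose proof (@cvg_ratio_subr_powR R _ _
    (n%:R + 2 * rho2 - 2 * r1) (n%:R + 2 * rho2 - 2 * r2) _
    n%:R (n%:R - 2 * r1 - 2 * r2)
    (2 * n%:R + 2 * BI_kappa rho1 rho2 r1 r2) ga0 hh) as key.
  set l := (X in _ --> X) in key; set l' := (X in _ --> X).
  have <- : l = l'.
    by rewrite /l /l'; field; apply: contra_neq ga0 => E; lra.
  apply: cvg_trans key; apply: near_eq_cvg; near=> q => /=.
  have q0 : 0 < q by near: q; exact: nbhs_left_gt.
  rewrite Qhat_CE// -signr_odd on expr1 !mulN1r !opprK !invfM; ring.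
- pose proof (@cvg_ratio_subr_powR R _ _
    n%:R (n%:R - 2 * r1 - 2 * r2) _
    (n%:R + 2 * rho2 - 2 * r1) (n%:R + 2 * rho2 - 2 * r2)
    (2 * n%:R + 2 * BI_kappa rho1 rho2 r1 r2) ga0 hh) as key.
  set l := (X in _ --> X) in key; set l' := (X in _ --> X).
  have <- : l = l'.
    by rewrite /l /l'; field; apply: contra_neq ga0 => E; lra.
  apply: cvg_trans key; apply: near_eq_cvg; near=> q => /=.
  have q0 : 0 < q by near: q; exact: nbhs_left_gt.
  rewrite Qhat_CE// -signr_odd on expr0 !mul1r !invfM; ring.
Unshelve. all: by end_near.
Qed.

(* [R[i]^o] is [R[i]] with the topology given by the modulus. *)
Theorem mainTheorem5 (R : realType) (rho1 rho2 r1 r2 : R)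
    (hrho : forall m : nat, rho1 + rho2 - r1 - r2 <> - (m.+1)%:R)
    (n : nat) (x : R[i]) :
  (let p := - q in
   let a := q `^ (2 * rho1 + 1 / 2) in
   let b := - q `^ (- 2 * r2 + 1 / 2) in
   let c := - q `^ (2 * rho2 + 1 / 2) in
   let d := q `^ (- 2 * r1 + 1 / 2) in
   ceval (Qhat p a b c d n) (cpow q x - cpow q (- x))
     / ((q - q^-1) ^+ n)%:C) @[q --> (1 : R)^'-]
  --> (2 ^+ n * ceval (BannaiIto rho1 rho2 r1 r2 n) ((x - 1 / 2) / 2) : R[i]^o).
Proof.
set A := BI_A rho1 rho2 r1 r2; set C := BI_C rho1 rho2 r1 r2.
have hA k := cvg_Qhat_A (hrho k).
have hC k : Qhat_C (- q) (q `^ (2 * rho1 + 1 / 2)) (- q `^ (- 2 * r2 + 1 / 2))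
    (- q `^ (2 * rho2 + 1 / 2)) (q `^ (- 2 * r1 + 1 / 2)) k / (q - q^-1)
    @[q --> (1 : R)^'-] --> 2 * C k.
  (* Index 0 is separate: both C_0 are zero by convention. *)
  case: k => [|k]; last exact: cvg_Qhat_C.
  rewrite /C /BI_C /= mulr0; apply: cvg_near_cst; apply: nearW => q.
  by rewrite /Qhat_C /= mul0r.
have u0 : \forall q \near (1 : R)^'-, q - q^-1 != 0.
  near=> q; have q0 : 0 < q by near: q; exact: nbhs_left_gt.
  have q1 : q < 1 by near: q; exact: nbhs_left_lt.
  by rewrite subr_eq0 lt_eqF// (lt_trans q1)// invf_gt1.
(* Write a - a^-1 as (1 - a^-1) - (1 - a); each bracket contributes half of the exponent of a. *)
have ha : (q `^ (2 * rho1 + 1 / 2) - (q `^ (2 * rho1 + 1 / 2))^-1) / (q - q^-1)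
    @[q --> (1 : R)^'-] --> 2 * rho1 + 1 / 2.
  pose proof (cvgB (@cvg_subr_powR R (- (2 * rho1 + 1 / 2)))
                (@cvg_subr_powR R (2 * rho1 + 1 / 2))) as key.
  have E : - - (2 * rho1 + 1 / 2) / 2 - - (2 * rho1 + 1 / 2) / 2 =
    2 * rho1 + 1 / 2 by field.
  rewrite E in key.
  apply: cvg_trans key; apply: near_eq_cvg; apply: nearW => q; rewrite ?fctE /=.
  rewrite powRN; ring.
(* The affine substitution with s = 2 and t = 1/2 moves the target to the point x. The shift 1/2
   matches the surplus in the limit 2 rho1 + 1/2 of (a - a^-1) / (q - q^-1). *)
have -> : 2 ^+ n * ceval (BannaiIto rho1 rho2 r1 r2 n) ((x - 1 / 2) / 2) =
    ceval (three_term (fun k => 2 * (rho1 - A k - C k) + 1 / 2)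
             (fun k => 2 ^+ 2 * (A k.-1 * C k)) n) x.
  rewrite ceval_three_term_affine ?pnatr_eq0//.
  by rewrite rmorphXn !rmorphM fmorphV !rmorph_nat rmorph1.
apply: cvg_three_term => // [k|k|]; last exact: cvg_cpow_subr.
- pose proof (cvgB (cvgB ha (hA k)) (hC k)) as key.
  have E : 2 * rho1 + 1 / 2 - 2 * A k - 2 * C k =
    2 * (rho1 - A k - C k) + 1 / 2 by ring.
  rewrite E in key.
  apply: cvg_trans key; apply: near_eq_cvg; apply: nearW => q; rewrite ?fctE /=.
  ring.
(* At k = 0 the truncated index gives [A 0 * C 0], which is zero because [C 0] is. *)
- pose proof (cvgM (hA k.-1) (hC k)) as key.
  have E : 2 * A k.-1 * (2 * C k) = 2 ^+ 2 * (A k.-1 * C k) by ring.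
  rewrite E in key.
  apply: cvg_trans key; apply: near_eq_cvg; apply: nearW => q; rewrite ?fctE /=.
  by rewrite expr2 invfM /GRing.mul_fun /=; ring.
Unshelve. all: by end_near.
Qed.
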